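(* Let $G$ be a graph whose least adjacency eigenvalue is $-2$ and whose minimum degree satisfies $\delta\ge 4$. Then the iterated line graphs $\mathcal{L}^k(G)$ have property $\varrho$ for every $k\ge 1$.
   Context: $\mathcal{L}^k$ is the $k$-th iterated line graph ($\mathcal{L}^1=\mathcal{L}$ the line graph). A graph has property $\varrho$ if all its negative adjacency eigenvalues equal $-2$. *)

(* Defs.v *)
From mathcomp Require Import all_boot all_order all_algebra.
From mathcomp Require Import reals.

Set Implicit Arguments.
Unset Strict Implicit.
Unset Printing Implicit Defensive.

Record sgraph := SGraph {
  vertex :> finType;
  adj : rel vertex;
  adj_sym : symmetric adj;
  adj_irrefl : irreflexive adj }.

Definition edges (G : sgraph) : {set {set G}} :=
  [set e : {set G} | [exists u : G, exists v : G, adj u v && (e == [set u; v])]].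

Definition degree (G : sgraph) (v : G) : nat := #|[set w : G | adj v w]|.

(* Every degree is smaller than #|G|, so the default value of the big
   operator is immaterial unless G has no vertex, where it gives 0. *)
Definition min_degree (G : sgraph) : nat :=
  \big[minn/#|G|]_(v : G) degree v.

Section LineGraph.
Variable G : sgraph.

Definition edge_type : finType := {e : {set G} | e \in edges G}.

Definition line_adj : rel edge_type :=
  fun e f => (e != f) && (val e :&: val f != set0).

Lemma line_adj_sym : symmetric line_adj.
Proof. by move=> e f; rewrite /line_adj eq_sym setIC. Qed.

Lemma line_adj_irrefl : irreflexive line_adj.
Proof. by move=> e; rewrite /line_adj eqxx. Qed.

Definition line_graph : sgraph := SGraph line_adj_sym line_adj_irrefl.

End LineGraph.

Definition iter_line_graph (k : nat) (G : sgraph) : sgraph :=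
  iter k line_graph G.

Local Open Scope ring_scope.

(* The vertices are listed in the order of [enum G]; the spectrum does not
   depend on this choice. *)
Definition adjacency_mx (R : realType) (G : sgraph) : 'M[R]_#|G| :=
  \matrix_(i, j) (adj (enum_val i) (enum_val j))%:R.

(* The adjacency matrix is real symmetric, so its real eigenvalues are all of
   its eigenvalues. *)
Definition adj_eigenvalue (R : realType) (G : sgraph) (a : R) : Prop :=
  eigenvalue (adjacency_mx R G) a.

Definition least_adj_eigenvalue (R : realType) (G : sgraph) (a : R) : Prop :=
  adj_eigenvalue G a /\ forall b : R, adj_eigenvalue G b -> a <= b.

Definition property_rho (R : realType) (G : sgraph) : Prop :=
  forall a : R, adj_eigenvalue G a -> a < 0 -> a = - 2.

(* Main.v *)
Require Import Defs.
From mathcomp Require Import all_boot all_order all_algebra.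
From mathcomp Require Import reals complex spectral sesquilinear.
From mathcomp Require Import ring lra.

(* Let N be the vertex-edge incidence matrix of G.  Then N^T N = A(L(G)) + 2
   and N N^T = A(G) + D(G), with D(G) the diagonal matrix of degrees, so an
   eigenvalue a <> -2 of the line graph yields the eigenvalue a + 2 of
   A(G) + D(G).  If A(G) >= -2 and all degrees are at least 4, the latter
   matrix is at least 2, whence a >= 0.  Both hypotheses are inherited by the
   line graph: A(L(G)) + 2 is a Gram matrix, and the edge uv has degree
   deg u + deg v - 2 >= 6 in L(G). *)

Set Implicit Arguments.
Unset Strict Implicit.
Unset Printing Implicit Defensive.
Import Order.TTheory GRing.Theory Num.Theory.

Lemma leq_min_degree (G : sgraph) (v : G) : min_degree G <= degree v.
Proof.
rewrite /min_degree.
have : v \in index_enum G by rewrite mem_index_enum.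
(* [minn] has no neutral element on the naturals, hence a direct induction over the index list. *)
elim: (index_enum G) => //= w s IHs; rewrite inE big_cons => /orP[/eqP->|/IHs].
  exact: geq_minl.
by apply: leq_trans; exact: geq_minr.
Qed.

(** * Counting incidences between vertices and edges *)

Section Incidence.

Variable G : sgraph.

Lemma edgeP (e : edge_type G) :
  exists u v : G, [/\ adj u v, u != v & val e = [set u; v]].
Proof.
have := valP e; rewrite inE => /existsP[u /existsP[v /andP[uv /eqP->]]].
exists u, v; split=> //; apply: contraTneq uv => ->.
by rewrite adj_irrefl.
Qed.

Lemma card_edge (e : edge_type G) : #|val e| = 2.
Proof. by have [u [v [_ uv ->]]] := edgeP e; rewrite cards2 uv. Qed.

Lemma adj_edge (u v : G) : adj u v -> [set u; v] \in edges G.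
Proof.
move=> uv; rewrite inE.
by apply/existsP; exists u; apply/existsP; exists v; rewrite uv /=.
Qed.

Definition edge_of (u v : G) (uv : adj u v) : edge_type G := 
  exist (fun e => e \in edges G) [set u; v] (adj_edge uv).

(** The entries of N^T N: an edge has two vertices, and distinct edges share at most one. *)
Lemma cards_edge_cap (e f : edge_type G) :
  #|val e :&: val f| = @adj (line_graph G) e f + 2 * (e == f).
Proof.
have [<-|ef] := eqVneq e f.
  by rewrite setIid card_edge adj_irrefl.
rewrite /= /line_adj ef /= addn0 -card_gt0.
suff : #|val e :&: val f| < 2 by case: #|_| => [|[]].
rewrite ltnNge; apply: contra ef => le2.
(* An intersection with two elements fills both edges, which forces [e = f]. *)
have eqI (g : edge_type G) :
    val e :&: val f \subset val g -> val e :&: val f = val g.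
  by move=> sub; apply/eqP; rewrite eqEcard sub card_edge.
by apply/eqP/val_inj; rewrite -[LHS](eqI e) ?subsetIl // (eqI f) ?subsetIr.
Qed.

Lemma edge_containing_pair (u v : G) (e : edge_type G) :
  u != v -> u \in val e -> v \in val e -> val e = [set u; v].
Proof.
move=> uv ue ve; apply/eqP.
rewrite eq_sym eqEcard cards2 uv card_edge leqnn andbT.
by apply/subsetP=> w; rewrite !inE => /orP[]/eqP->.
Qed.

(** The map sending [w] to [[set u; w]] is a bijection from the neighbours of [u] to the edges at
    [u]. *)
Lemma card_incident_edges (u : G) :
  #|[set e : edge_type G | u \in val e]| = degree u.
Proof.
rewrite /degree -(card_imset _ val_inj).
have inj : {in [set w | adj u w] &, injective (fun w => [set u; w])}.
  move=> w w'; rewrite !inE => uw uw' /setP/(_ w); rewrite !inE eqxx orbT.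
  case/esym/orP=> /eqP // wu; move: uw; by rewrite wu adj_irrefl.
rewrite -(card_in_imset inj); apply: eq_card => e; apply/imsetP/imsetP.
  case=> f; rewrite inE => uf ->; have [a [b [ab _ fE]]] := edgeP f.
  move: uf; rewrite fE !inE => /orP[]/eqP->; first by exists b; rewrite ?inE.
  by exists a; rewrite ?inE 1?adj_sym // setUC.
case=> w; rewrite inE => uw ->.
by exists (edge_of uw); rewrite ?inE /= ?inE ?eqxx.
Qed.

(** The entries of N N^T: two distinct vertices lie on at most one common edge, and on one exactly
    when adjacent. *)
Lemma card_common_edges (u v : G) :
  #|[set e : edge_type G | (u \in val e) && (v \in val e)]| =
  adj u v + degree u * (u == v).
Proof.
have [<-|uv] := eqVneq u v.
  rewrite adj_irrefl muln1 -card_incident_edges; apply: eq_card => e.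
  by rewrite !inE andbb.
rewrite muln0 addn0; have [uv_adj|nuv] := boolP (adj u v).
  apply/eqP/cards1P; exists (edge_of uv_adj).
  apply/setP=> e; rewrite !inE -val_eqE /=; apply/andP/eqP => [[ue ve]|->].
    exact: edge_containing_pair.
  by rewrite !inE !eqxx orbT.
apply/eqP; rewrite cards_eq0; apply/eqP/setP=> e; rewrite !inE.
apply: contraNF nuv => /andP[ue ve].
have eE := edge_containing_pair uv ue ve.
have [a [b [ab anb]]] := edgeP e; rewrite eE => E.
(* Both [u] and [v] lie in the pair [a], [b]: equal choices contradict [u != v], the others make [u]
   and [v] adjacent. *)
move: (in_set2 u a b) (in_set2 v a b); rewrite -E !inE !eqxx orbT /=.
case/esym/orP=> /eqP ?; case/esym/orP=> /eqP ?; subst.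
all: by rewrite ?eqxx // in uv *; rewrite 1?adj_sym.
Qed.

(** Double counting of the pairs [(v, f)] with [v] in both [e] and [f]; the 2 is the contribution of
    [f = e]. *)
Lemma degree_line_graph (e : edge_type G) :
  @degree (line_graph G) e + 2 = \sum_(v in val e) degree v.
Proof.
transitivity (\sum_(f : edge_type G) #|val e :&: val f|).
  under eq_bigr do rewrite cards_edge_cap.
  rewrite big_split /= -big_distrr /=; congr (_ + _).
    rewrite /degree -sum1dep_card big_mkcond.
    by apply: eq_bigr => f _ /=; case: line_adj.
  by rewrite (bigD1 e) //= eqxx big1 // => f; rewrite eq_sym => /negPf->.
under eq_bigr => f _.
  rewrite -sum1_card (eq_bigl (fun v => (v \in val e) && (v \in val f))).
    rewrite big_mkcondr /=; over.
  by move=> v; rewrite inE.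
rewrite exchange_big; apply: eq_bigr => v _ /=.
by rewrite -big_mkcond /= -card_incident_edges -sum1dep_card.
Qed.

End Incidence.

Local Open Scope ring_scope.

(** * Rayleigh bound for real symmetric matrices, by complex diagonalization *)

Section Rayleigh.

Local Open Scope complex_scope.
Local Open Scope sesquilinear_scope.
Variables (R : rcfType) (n : nat) (A : 'M[R]_n).
Hypothesis A_sym : A^T = A.

Let f : {rmorphism R -> R[i]} := real_complex R.
Let Ac : 'M[R[i]]_n := map_mx f A.

Lemma map_real_complex_realmx m p (B : 'M[R]_(m, p)) : map_mx f B \is a realmx.
Proof. by apply/mxOverP => i j; rewrite mxE complex_real. Qed.

Lemma sym_map_hermsymmx : Ac \is hermsymmx.
Proof.
apply: realsym_hermsym; last exact: map_real_complex_realmx.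
apply/is_hermitianmxP; rewrite expr0 scale1r map_mx_id //.
by rewrite /Ac map_trmx A_sym.
Qed.

Lemma sym_spectral_diag_eigenvalue i :
  exists2 b, eigenvalue A b & spectral_diag Ac 0 i = f b.
Proof.
have Aherm := sym_map_hermsymmx.
have /mxOverP/(_ 0 i)/complex_realP[b def_b] :=
  hermitian_spectral_diag_real Aherm.
exists b => //; rewrite eigenvalue_root_char -(fmorph_root f) map_char_poly.
rewrite -eigenvalue_root_char -/Ac -[f b]def_b.
have Punit := spectral_unit Ac.
have /orthomx_spectralP def_A := hermitian_normalmx Aherm.
(* With P = [spectralmx Ac] and D the diagonal factor, P [Ac] = D P, so the rows of P are left
   eigenvectors. *)
apply/eigenvalueP; exists (row i (spectralmx Ac)).
  rewrite -row_mul {2}def_A !mulmxA mulmxV // mul1mx.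
  by rewrite row_mul row_diag_mx -scalemxAl -rowE.
(* A zero row i would put [delta_mx 0 i] in the left kernel of the invertible matrix P. *)
apply: contraTneq Punit => Pi0; rewrite -row_free_unit -kermx_eq0.
apply/rowV0Pn; exists (delta_mx 0 i); last first.
  apply/eqP => /rowP/(_ i); rewrite !mxE !eqxx => /eqP.
  by rewrite oner_eq0.
by apply/sub_kermxP; rewrite -rowE.
Qed.

(** In the coordinates [z] of [x] in a unitary eigenbasis, both sides become sums of [|z 0 i| ^+ 2],
    weighted by [c] and by the eigenvalues. *)
Lemma sym_eigenvalue_lower_bound (c : R) (x : 'rV[R]_n) :
  (forall b, eigenvalue A b -> c <= b) ->
  c * (x *m x^T) 0 0 <= (x *m A *m x^T) 0 0.
Proof.
move=> le_c; pose xc : 'rV[R[i]]_n := map_mx f x.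
pose P := spectralmx Ac; pose z := xc *m P^t*.
have PU : P \is unitarymx := spectral_unitarymx Ac.
have /orthomx_spectralP := hermitian_normalmx sym_map_hermsymmx.
rewrite -/P invmx_unitary // => def_A.
have xcT : xc ^T = xc ^t*.
  by rewrite realmxC // map_trmx map_real_complex_realmx.
have zT : z ^t* = P *m xc ^T.
  by rewrite /z trmx_mul map_mxM trmxCK -xcT.
have normE : f ((x *m x^T) 0 0) = \sum_i `|z 0 i| ^+ 2.
  transitivity ((xc *m xc^T) 0 0).
    by rewrite /xc map_trmx -map_mxM [RHS]mxE.
  transitivity ((z *m z^t*) 0 0).
    rewrite zT /z mulmxA -(mulmxA xc).
    by rewrite -invmx_unitary // mulVmx ?unitarymx_unit // mulmx1.
  by rewrite mxE; apply: eq_bigr => i _; rewrite normCK !mxE.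
have formE : f ((x *m A *m x^T) 0 0) =
    \sum_i spectral_diag Ac 0 i * `|z 0 i| ^+ 2.
  transitivity ((xc *m Ac *m xc^T) 0 0).
    by rewrite /xc map_trmx -!map_mxM [RHS]mxE.
  transitivity ((z *m diag_mx (spectral_diag Ac) *m z^t*) 0 0).
    by rewrite {1}def_A zT /z !mulmxA.
  rewrite mxE; apply: eq_bigr => i _.
  by rewrite normCK mul_mx_diag !mxE mulrAC mulrC.
rewrite -lecR -[_%:C]/(f _) -[X in _ <= X]/(f _) rmorphM /= normE formE.
rewrite mulr_sumr; apply: ler_sum => i _.
have [b /le_c cb ->] := sym_spectral_diag_eigenvalue i.
by rewrite ler_wpM2r ?exprn_ge0 // lecR.
Qed.

End Rayleigh.

(** * Quadratic forms and eigenvectors of line graphs *)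

Section LineSpectrum.

Variables (R : realType) (G : sgraph).
Implicit Type x : edge_type G -> R.

(** Vectors are functions on the vertices, which keeps the enumeration out of the combinatorial
    arguments. *)
Definition adj_form (H : sgraph) (y : H -> R) : R :=
  \sum_(u : H) \sum_(v : H) (adj u v)%:R * y u * y v.

Lemma adj_eigenvalueP (H : sgraph) (a : R) : adj_eigenvalue H a ->
  exists2 y : H -> R, (exists v, y v != 0) &
    forall v, \sum_u (adj u v)%:R * y u = a * y v.
Proof.
case/eigenvalueP=> w wA w0; exists (fun v => w 0 (enum_rank v)).
  case/rV0Pn: w0 => i wi; exists (enum_val i); by rewrite enum_valK.
move=> v; have /rowP/(_ (enum_rank v)) := wA; rewrite !mxE => <-.
rewrite (reindex (@enum_val H predT)) /=; last exact/onW_bij/enum_val_bij.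
by apply: eq_bigr => i _; rewrite mxE enum_rankK enum_valK mulrC.
Qed.

Definition incidence (v : G) (e : edge_type G) : R := (v \in val e)%:R.

(** The vector N x. *)
Definition vertex_sum x (v : G) : R := \sum_e incidence v e * x e.

Lemma sum_incidence_vertices e f :
  \sum_v incidence v e * incidence v f =
  (@adj (line_graph G) e f)%:R + 2 * (e == f)%:R.
Proof.
rewrite -natrM -natrD -cards_edge_cap -sum1_card natr_sum [RHS]big_mkcond /=.
by apply: eq_bigr => v _; rewrite /incidence -natrM mulnb inE; case: ifP.
Qed.

Lemma sum_incidence_edges u v :
  \sum_e incidence u e * incidence v e =
  (adj u v)%:R + (degree u)%:R * (u == v)%:R.
Proof.
rewrite -natrM -natrD -card_common_edges -sum1_card natr_sum [RHS]big_mkcond /=.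
by apply: eq_bigr => e _; rewrite /incidence -natrM mulnb inE; case: ifP.
Qed.

Lemma sum_delta (T : finType) (t : T) (F : T -> R) :
  \sum_s (t == s)%:R * F s = F t.
Proof.
rewrite (bigD1 t) //= eqxx mul1r big1 ?addr0 // => s /negPf.
by rewrite eq_sym => ->; rewrite mul0r.
Qed.

(** N^T (N x) = (A(L(G)) + 2) x, read at the coordinate [e]. *)
Lemma incidence_vertex_sum x e :
  \sum_v incidence v e * vertex_sum x v =
  \sum_f (@adj (line_graph G) e f)%:R * x f + 2 * x e.
Proof.
under eq_bigr do rewrite mulr_sumr.
rewrite exchange_big /= -[X in 2 * X](sum_delta e) mulr_sumr -big_split /=.
apply: eq_bigr => f _; rewrite mulrA -mulrDl -sum_incidence_vertices mulr_suml.
by apply: eq_bigr => v _; rewrite mulrA.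
Qed.

(** N (N^T y) = (A(G) + D(G)) y, read at the coordinate [u]. *)
Lemma incidence_edge_sum (y : G -> R) u :
  \sum_e incidence u e * (\sum_v incidence v e * y v) =
  \sum_v (adj u v)%:R * y v + (degree u)%:R * y u.
Proof.
under eq_bigr do rewrite mulr_sumr.
rewrite exchange_big /= -[X in _ + _ * X](sum_delta u) mulr_sumr -big_split /=.
apply: eq_bigr => v _; rewrite mulrA -mulrDl -sum_incidence_edges mulr_suml.
by apply: eq_bigr => e _; rewrite mulrA.
Qed.

(** Pairing N^T N x with [x] gives the squared norm of N x. *)
Lemma line_graph_form x :
  @adj_form (line_graph G) x + 2 * \sum_e x e ^+ 2 =
  \sum_v vertex_sum x v ^+ 2.
Proof.
transitivity (\sum_e x e * \sum_v incidence v e * vertex_sum x v).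
  rewrite /adj_form mulr_sumr -big_split /=; apply: eq_bigr => e _.
  rewrite incidence_vertex_sum mulrDr mulr_sumr; congr (_ + _); last by ring.
  by apply: eq_bigr => f _; ring.
under eq_bigr do rewrite mulr_sumr.
rewrite exchange_big; apply: eq_bigr => v _.
rewrite expr2 {2}/vertex_sum mulr_suml; apply: eq_bigr => e _; ring.
Qed.

Lemma line_graph_form_ge x :
  - 2 * \sum_e x e ^+ 2 <= @adj_form (line_graph G) x.
Proof.
have : 0 <= \sum_v vertex_sum x v ^+ 2.
  by apply: sumr_ge0 => v _; exact: sqr_ge0.
by rewrite -line_graph_form; lra.
Qed.

Lemma line_graph_property_rho :
  (forall v : G, (4 <= degree v)%N) ->
  (forall y : G -> R, - 2 * \sum_v y v ^+ 2 <= adj_form y) ->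
  property_rho R (line_graph G).
Proof.
move=> deg4 form_ge a /adj_eigenvalueP[x [e0 xe0] xA] a_lt0.
pose y := vertex_sum x.
(* N^T y = N^T N x = (a + 2) x; applying N then makes [y] satisfy the eigenvalue equation of A(G) +
   D(G) for a + 2. *)
have edge_eq e : \sum_v incidence v e * y v = (a + 2) * x e.
  rewrite incidence_vertex_sum [RHS]mulrDl -xA; congr (_ + _).
  by apply: eq_bigr => f _; rewrite adj_sym.
have vertex_eq u :
    \sum_v (adj u v)%:R * y v + (degree u)%:R * y u = (a + 2) * y u.
  rewrite -incidence_edge_sum {2}/y /vertex_sum mulr_sumr.
  by apply: eq_bigr => e _; rewrite edge_eq; ring.
have normE :
    adj_form y + \sum_u (degree u)%:R * y u ^+ 2 = (a + 2) * \sum_u y u ^+ 2.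
  rewrite /adj_form mulr_sumr -big_split /=; apply: eq_bigr => u _.
  rewrite expr2 [RHS]mulrA -vertex_eq mulrDl mulr_suml mulrA; congr (_ + _).
  by apply: eq_bigr => v _; ring.
have deg_ge : 4 * \sum_u y u ^+ 2 <= \sum_u (degree u)%:R * y u ^+ 2.
  rewrite mulr_sumr; apply: ler_sum => u _.
  by rewrite ler_wpM2r ?sqr_ge0 // ler_nat.
have sq_ge0 (u : G) : true -> 0 <= y u ^+ 2 by rewrite sqr_ge0.
(* With S the sum of squares, the form and degree bounds give (4 - 2) S <= (a + 2) S, so a S >= 0,
   and [a < 0] forces S = 0. *)
have y0 : \sum_u y u ^+ 2 = 0.
  have := form_ge y; have : 0 <= \sum_u y u ^+ 2 by exact: sumr_ge0.
  by move: normE deg_ge a_lt0; clear; nra.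
have {}y0 u : y u = 0.
  by have /psumr_eq0P/(_ u isT)/eqP := y0; rewrite sqrf_eq0 => /(_ sq_ge0)/eqP.
(* Now N^T y = 0, so (a + 2) x vanishes at [e0], where [x] does not. *)
have /esym/eqP := edge_eq e0.
rewrite big1 => [|v _]; last by rewrite y0 mulr0.
by rewrite mulf_eq0 (negPf xe0) orbF addr_eq0 => /eqP.
Qed.

End LineSpectrum.

(** * Passage to iterated line graphs *)

Lemma line_graph_degree_ge4 (G : sgraph) :
  (forall v : G, (4 <= degree v)%N) ->
  forall e : line_graph G, (4 <= degree e)%N.
Proof.
move=> deg4 e; rewrite -(leq_add2r 2) degree_line_graph.
apply: (@leq_trans (\sum_(v in val e) 4)); last exact: leq_sum.
by rewrite sum_nat_const card_edge.
Qed.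

Lemma least_adj_eigenvalue_form_ge (R : realType) (G : sgraph) (c : R) :
  least_adj_eigenvalue G c ->
  forall y : G -> R, c * \sum_v y v ^+ 2 <= adj_form y.
Proof.
case=> _ c_le y; pose x : 'rV[R]_#|G| := \row_i y (enum_val i).
have A_sym : (adjacency_mx R G)^T = adjacency_mx R G.
  by apply/matrixP=> i j; rewrite !mxE adj_sym.
have := sym_eigenvalue_lower_bound A_sym x c_le.
have enum_bij : {on predT, bijective (@enum_val G predT)}.
  exact/onW_bij/enum_val_bij.
congr (_ * _ <= _).
  rewrite mxE (reindex _ enum_bij); apply: eq_bigr => i _.
  by rewrite !mxE expr2.
(* The product [x *m A *m x^T] sums over columns outermost, hence the exchange. *)
rewrite mxE /adj_form exchange_big (reindex _ enum_bij).
apply: eq_bigr => j _; rewrite !mxE (reindex _ enum_bij) mulr_suml.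
by apply: eq_bigr => i _; rewrite !mxE [y _ * _]mulrC.
Qed.

Theorem theorem4p13 (R : realType) (G : sgraph)
    (hleast : least_adj_eigenvalue (R := R) G (- 2))
    (hdeg : (4 <= min_degree G)%N) (k : nat) (hk : (1 <= k)%N) :
  property_rho R (iter_line_graph k G).
Proof.
case: k hk => // k _.
have deg4 v : (4 <= degree v)%N := leq_trans hdeg (leq_min_degree v).
have form_ge := least_adj_eigenvalue_form_ge hleast.
(* The invariant records the spectral hypothesis as a bound on the form, which the Gram identity
   supplies for every line graph. *)
suff [] : (forall v : iter_line_graph k G, (4 <= degree v)%N) /\
    forall y : iter_line_graph k G -> R, - 2 * \sum_v y v ^+ 2 <= adj_form y.
  exact: line_graph_property_rho.
elim: k => [//|k [IHdeg _]].
by split; [exact: line_graph_degree_ge4 | exact: line_graph_form_ge].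
Qed.
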